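(* Let $G=(V,E)$ be a graph with $n\geq 4$ vertices such that $G$ and its complement $\overline{G}$ are both connected. Then: (1) $10\leq tr(G)+tr(\overline{G})\leq 2n+4$; (2) $25\leq tr(G)\cdot tr(\overline{G})\leq 12(n-1)$, except for $G$ in the finite family $\mathcal{F}$ of graphs described in the context. Moreover, the bounds are tight (each of the four bounds is attained by some such graph).
   Context: All graphs are finite, simple and undirected. $d(u,v)$ denotes the usual shortest-path distance. The triameter of a connected graph $G=(V,E)$ on at least $3$ vertices is $tr(G)=\max\{d(u,v)+d(v,w)+d(u,w): u,v,w\in V\}$. $\overline{G}$ is the complement of $G$, and $diam$ denotes the diameter. The family $\mathcal{F}$ (finite up to isomorphism) is $$\mathcal{F}=\{G:\ |G|\in\{5,6,7\};\ diam(G)=diam(\overline{G})=3;\ tr(G),tr(\overline{G})\in\{7,8,9\}\},$$ where $|G|$ is the number of vertices and $G,\overline{G}$ are both connected. *)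

(* Defs.v *)
From mathcomp Require Import all_boot.

Set Implicit Arguments.
Unset Strict Implicit.
Unset Printing Implicit Defensive.

Record sgraph := SGraph {
  vertex :> finType;
  adj : rel vertex;
  adj_sym : symmetric adj;
  adj_irrefl : irreflexive adj
}.

Section Complement.
Variable G : sgraph.

Definition compl_adj : rel G := fun x y => (x != y) && ~~ adj x y.

Lemma compl_adj_sym : symmetric compl_adj.
Proof. by move=> x y; rewrite /compl_adj eq_sym adj_sym. Qed.

Lemma compl_adj_irrefl : irreflexive compl_adj.
Proof. by move=> x; rewrite /compl_adj eqxx. Qed.

Definition complement : sgraph := SGraph compl_adj_sym compl_adj_irrefl.
End Complement.

Definition connected (G : sgraph) : Prop :=
  forall x y : G, connect (@adj G) x y.

Definition has_walk (G : sgraph) (x y : G) (k : nat) : bool :=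
  [exists p : k.-tuple G, path (@adj G) x p && (last x p == y)].

(* A shortest path has fewer than #|G| edges, so searching the lengths
   0, ..., #|G| - 1 suffices; if no walk joins x to y the value is the
   default #|G|. *)
Definition dist (G : sgraph) (x y : G) : nat :=
  find (has_walk x y) (iota 0 #|G|).

Lemma dist_min (G : sgraph) (x : G) (p : seq G) :
  path (@adj G) x p -> dist x (last x p) <= size p.
Proof.
move=> pth; have walk q : path (@adj G) x q -> last x q = last x p ->
    has_walk x (last x p) (size q).
  move=> pq lq; apply/existsP; exists (in_tuple q).
  by rewrite /= pq lq eqxx.
rewrite leqNgt; apply/negP => lt.
have szG : size p < #|G|.
  apply: leq_trans lt _; rewrite -[leqRHS](size_iota 0); exact: find_size.
have := before_find 0 lt.
by rewrite nth_iota // add0n walk.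
Qed.

Lemma dist_witness (G : sgraph) (x y : G) :
  connect (@adj G) x y ->
  exists p, [/\ path (@adj G) x p, last x p = y & size p = dist x y].
Proof.
case/connectP => p0 pth0 ->; case/shortenP: pth0 => p pth un _.
have szp : size p < #|G| by rewrite -[(size p).+1]/(size (x :: p)) -(card_uniqP un) max_card.
have hs : has (has_walk x (last x p)) (iota 0 #|G|).
  apply/hasP; exists (size p); first by rewrite mem_iota add0n szp.
  by apply/existsP; exists (in_tuple p); rewrite /= pth eqxx.
have := nth_find 0 hs.
have lt : find (has_walk x (last x p)) (iota 0 #|G|) < #|G|.
  by rewrite -[ltnRHS](size_iota 0) -has_find.
rewrite nth_iota // add0n => /existsP[q /andP[pq /eqP lq]].
by exists q; split=> //; rewrite size_tuple.
Qed.

Definition diameter (G : sgraph) : nat :=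
  \max_(u : G) \max_(v : G) dist u v.

Definition triameter (G : sgraph) : nat :=
  \max_(u : G) \max_(v : G) \max_(w : G) (dist u v + dist v w + dist u w).

Definition co_connected (G : sgraph) : Prop :=
  connected G /\ connected (complement G).

Definition in_family_F (G : sgraph) : Prop :=
  [/\ co_connected G,
      #|G| \in [:: 5; 6; 7],
      diameter G = 3 /\ diameter (complement G) = 3,
      triameter G \in [:: 7; 8; 9]
    & triameter (complement G) \in [:: 7; 8; 9]].

(* Main.v *)
Require Import Defs.
From mathcomp Require Import all_boot.
From mathcomp Require Import zify.

Set Implicit Arguments.
Unset Strict Implicit.
Unset Printing Implicit Defensive.

(** Write G' for the complement of G and n for the number of vertices.

    Lower bounds.  G' is connected on at least three vertices, so some vertex
    c has two neighbours a, b in G'.  In G the perimeter of a, c, b is then at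
    least 2 + 2 + 1 (triameter_ge5), and G, G' play symmetric roles.

    Upper bounds.  A tree spanned by geodesics gives tr(G) <= 2(n - 1)
    (triameter_le_card).  If one of the triameters is at most 6, this bound on
    the other one gives both inequalities.  The remaining case, where both
    triameters exceed 6, rests on one observation: if x and y are at distance
    at least 3 in G', then xy is an edge of G and every vertex is equal or
    adjacent to x or to y (codist_gt2_dominating).  Such an edge exists in G,
    and likewise in G', when tr(G), tr(G') > 6.  Consequently:
    - all distances are at most 3, so both diameters are 3;
    - no three vertices of G are pairwise at distance 3, since two of them
      would lie next to the same end of xy; so both triameters are at most 8
      (triameter_le8);
    - if n = 5 and tr(G) = 8, the dominating edge leaves so little room that
      tr(G') <= 6 (complement_triameter_le6), so here both are at most 7.
    As tr(G) <= 2(n - 1) = 6 for n = 4, we have n >= 5, and the sum is at most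
    14 if n = 5 and at most 16 if n >= 6.  The graphs of this case with
    n <= 7 are in the family F; for n >= 8 the product is at most
    64 < 12(n - 1).

    The 4-vertex path and the 5-cycle are isomorphic to their complements,
    with triameters 6 and 5, and attain the upper and the lower bounds. *)

(** * Distances, perimeters and the triameter *)

Definition perimeter (G : sgraph) (u v w : G) : nat :=
  dist u v + dist v w + dist u w.

Lemma leq_triameter (G : sgraph) (u v w : G) : perimeter u v w <= triameter G.
Proof.
apply: leq_trans (leq_bigmax u); apply: leq_trans (leq_bigmax v).
exact: (leq_bigmax w).
Qed.

Lemma triameter_leP (G : sgraph) m :
  reflect (forall u v w : G, perimeter u v w <= m) (triameter G <= m).
Proof.
apply: (iffP idP) => [le_m u v w | le_m].
  exact: leq_trans (leq_triameter u v w) le_m.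
by do 3!(apply/bigmax_leqP => ? _); exact: le_m.
Qed.

Lemma triameter_gtP (G : sgraph) m :
  reflect (exists u v w : G, m < perimeter u v w) (m < triameter G).
Proof.
apply: (iffP idP) => [lt_m | [u [v [w lt_m]]]]; last first.
  exact: leq_trans lt_m (leq_triameter u v w).
have [/existsP[u /existsP[v /existsP[w lt]]] | none] :=
  boolP [exists u : G, exists v, exists w, m < perimeter u v w].
  by exists u, v, w.
suff: triameter G <= m by rewrite leqNgt lt_m.
apply/triameter_leP => u v w; rewrite leqNgt; apply: contra none => lt.
by apply/existsP; exists u; apply/existsP; exists v; apply/existsP; exists w.
Qed.

Lemma diameter_leP (G : sgraph) m :
  reflect (forall u v : G, dist u v <= m) (diameter G <= m).
Proof.
apply: (iffP idP) => [le_m u v | le_m].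
  apply: leq_trans le_m; apply: leq_trans (leq_bigmax u).
  exact: (leq_bigmax v).
by do 2!(apply/bigmax_leqP => ? _); exact: le_m.
Qed.

Lemma dist_refl (G : sgraph) (x : G) : dist x x = 0.
Proof. by apply/eqP; rewrite -leqn0 (@dist_min G x [::]). Qed.

Lemma dist_adj (G : sgraph) (x y : G) : adj x y -> dist x y <= 1.
Proof. by move=> xy; apply: (@dist_min G x [:: y]); rewrite /= xy. Qed.

Lemma dist_adj2 (G : sgraph) (x y z : G) :
  adj x z -> adj z y -> dist x y <= 2.
Proof. by move=> xz zy; apply: (@dist_min G x [:: z; y]); rewrite /= xz zy. Qed.

Lemma dist_adj3 (G : sgraph) (x a b y : G) :
  adj x a -> adj a b -> adj b y -> dist x y <= 3.
Proof.
by move=> xa ab by_; apply: (@dist_min G x [:: a; b; y]); rewrite /= xa ab by_.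
Qed.

Section Connected.
Variables (G : sgraph) (conG : connected G).
Implicit Types x y z u v w : G.

Lemma dist_triangle x y z : dist x z <= dist x y + dist y z.
Proof.
have [p [pp lp <-]] := dist_witness (conG x y).
have [q [pq lq <-]] := dist_witness (conG y z).
rewrite -size_cat.
have -> : z = last x (p ++ q) by rewrite last_cat lp lq.
by apply: dist_min; rewrite cat_path pp lp.
Qed.

Lemma dist_sym x y : dist x y = dist y x.
Proof.
suff le (a b : G) : dist a b <= dist b a by apply/eqP; rewrite eqn_leq !le.
have [p [pp <- <-]] := dist_witness (conG b a).
have end_rev : last (last b p) (rev (belast b p)) = b.
  by case: p {pp} => //= c p; rewrite rev_cons last_rcons.
have := @dist_min G (last b p) (rev (belast b p)).
rewrite end_rev size_rev size_belast; apply.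
by rewrite rev_path (@eq_path _ _ (@adj G)) // => c d; rewrite adj_sym.
Qed.

Lemma dist_gt2 u v :
    u != v -> ~~ adj u v -> (forall z, ~~ (adj u z && adj z v)) ->
  2 < dist u v.
Proof.
move=> neq nadj none; have [[|a [|b [|c p]]] [pp lp <-]] :=
  dist_witness (conG u v) => //=.
- by rewrite -lp eqxx in neq.
- by move: pp lp nadj => /= /andP[ua _] <-; rewrite ua.
- by move: pp lp (none a) => /= /and3P[-> ab _] <-; rewrite ab.
Qed.

Lemma geodesic u v :
  exists p, [/\ path (@adj G) u p, uniq (u :: p), last u p = v
              & size p = dist u v].
Proof.
have [p0 [pp0 lp0 sz0]] := dist_witness (conG u v).
case/shortenP: pp0 lp0 => p pp up sub lp; exists p; split=> //.
apply/eqP; rewrite eqn_leq -{2}lp dist_min // andbT -sz0.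
by apply: uniq_leq_size => //; case/andP: up.
Qed.

(** Stop a simple path at its first vertex in A. *)
Lemma path_to_set (A : pred G) x y : A y ->
  exists p, [/\ path (@adj G) x p, uniq (x :: p), A (last x p)
              & {in belast x p, forall z, ~~ A z}].
Proof.
move=> Ay; case/connectP: (conG x y) => p0 pp0 ey; move: Ay; rewrite ey.
case/shortenP: pp0 => p pp up _ Al {p0 ey y}.
suff [q [? ? ? ? _]] : exists q, [/\ path (@adj G) x q, uniq (x :: q),
  A (last x q), {in belast x q, forall z, ~~ A z} & {subset q <= p}].
  by exists q.
elim: p x pp up Al => [|y p IH] x /=; first by exists [::].
have [Ax _ _ _|nAx] := boolP (A x); first by exists [::].
case/andP=> xy pp /andP[xyp up] Al.
have [q [pq uq Aq nq sub]] := IH y pp up Al.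
have subq : {subset y :: q <= y :: p}.
  by move=> z; rewrite !inE => /predU1P[->|/sub->]; rewrite ?eqxx ?orbT.
exists (y :: q); split=> //=.
- by rewrite xy.
- by rewrite -/(uniq (y :: q)) uq andbT; apply: contra xyp; exact: subq.
- by move=> z; rewrite inE => /predU1P[->|/nq].
Qed.

(** Join a third vertex w by a path to a shortest path from u to v: the two
    paths form a tree, each of whose edges is used by exactly two of the three
    walks between u, v and w inside it; and a tree on at most n vertices has
    at most n - 1 edges. *)
Lemma triameter_le_card : triameter G <= 2 * (#|G| - 1).
Proof.
apply/triameter_leP => u v w.
have [p [pp up lp szp]] := geodesic u v.
have [q [pq uq Aq nq]] := @path_to_set (mem (u :: p)) w u (mem_head u p).
set z := last w q in Aq.
have dwz : dist w z <= size q by exact: dist_min.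
have [duz_zv] : dist u z + dist z v <= dist u v.
  rewrite -szp; case/splitPl: {nq up szp} p / Aq pp lp => p1 p2 <-.
  rewrite cat_path last_cat size_cat => /andP[pp1 pp2] <-.
  by rewrite leq_add // dist_min.
have card : (dist u v).+1 + size q <= #|G|.
  have uniq_tree : uniq ((u :: p) ++ belast w q).
    rewrite cat_uniq up /=; apply/andP; split.
      by apply/hasPn => y /nq.
    by move: uq; rewrite lastI rcons_uniq => /andP[].
  by rewrite -szp -[size q](size_belast w) -[_.+1]/(size (u :: p)) -size_cat
             -(card_uniqP uniq_tree) max_card.
have := dist_triangle v z w; have := dist_triangle u z w.
rewrite (dist_sym z w) (dist_sym v z) /perimeter; lia.
Qed.

(** In a graph of diameter 3 the thresholds m = 6, 7, 8 force at least one,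
    at least two, all three of the distances to be 3; the sorting says which ones. *)
Lemma sorted_triple m : m < triameter G ->
  exists a b c : G, [/\ m < dist a b + dist a c + dist b c,
    dist b c <= dist a c & dist a c <= dist a b].
Proof.
case/triameter_gtP => u [v [w]]; rewrite /perimeter => lt_m.
have [vu wv wu] := And3 (dist_sym v u) (dist_sym w v) (dist_sym w u).
case: (leqP (dist u v) (dist v w)) => ?;
case: (leqP (dist v w) (dist u w)) => ?;
case: (leqP (dist u v) (dist u w)) => ?;
first [ exists u, v, w; split; lia | exists u, w, v; split; lia
      | exists v, u, w; split; lia | exists v, w, u; split; lia
      | exists w, u, v; split; lia | exists w, v, u; split; lia ].
Qed.

Lemma exists_cherry : 3 <= #|G| ->
  exists c a b : G, [/\ a != b, adj a c & adj c b].
Proof.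
case/card_gt2P => x [y [z [_ [xy yz zx]]]].
(* A geodesic between two vertices that are not adjacent has an inner vertex. *)
have inner u v : u != v -> ~~ adj u v ->
    exists c a b : G, [/\ a != b, adj a c & adj c b].
  move=> uv nuv; have [[|c [|b p]] [pp up lp _]] := geodesic u v.
  - by rewrite /= in lp; rewrite lp eqxx in uv.
  - by move: pp lp nuv => /= /andP[uc _] <-; rewrite uc.
  - exists c, u, b; move: pp up => /= /and3P[-> -> _] /andP[+ _].
    by rewrite !inE !negb_or => /and3P[].
have [xy_adj|/(inner _ _ xy)//] := boolP (adj x y).
have [yz_adj|/(inner _ _ yz)//] := boolP (adj y z).
by exists y, x, z; rewrite eq_sym.
Qed.
End Connected.

(** * A graph against its complement *)

Definition dominates (G : sgraph) (x z : G) := (x == z) || adj x z.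

Section Complementary.
Variable G : sgraph.
Implicit Types x y z u v w : G.
Notation codist := (@dist (complement G)).

Lemma adj_complement x y : @adj (complement G) x y = ~~ dominates x y.
Proof. by rewrite /= /compl_adj /dominates negb_or. Qed.

Lemma dominates_sym x y : dominates x y = dominates y x.
Proof. by rewrite /dominates eq_sym adj_sym. Qed.

Lemma adj_complementK x y : @adj (complement (complement G)) x y = adj x y.
Proof.
rewrite /= /compl_adj /= /compl_adj; case: eqVneq => [->|_] /=.
  by rewrite adj_irrefl.
by rewrite negbK.
Qed.

Lemma dist_complementK x y : @dist (complement (complement G)) x y = dist x y.
Proof.
apply: eq_find => k; apply: eq_existsb => p.
by rewrite (eq_path adj_complementK).
Qed.

Lemma triameter_complementK :
  triameter (complement (complement G)) = triameter G.
Proof.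
by do 3!(apply: eq_bigr => ? _); rewrite !dist_complementK.
Qed.

Lemma connected_complementK :
  connected G -> connected (complement (complement G)).
Proof.
by move=> con x y; rewrite (eq_connect adj_complementK); exact: con.
Qed.

Lemma dist_dominates x y : dominates x y -> dist x y <= 1.
Proof. by case/orP => [/eqP->|/dist_adj//]; rewrite dist_refl. Qed.

Lemma codist_nondominated x y : ~~ dominates x y -> codist x y <= 1.
Proof. by rewrite -adj_complement => /dist_adj. Qed.

Lemma codist_commonly_nondominated x y z :
  ~~ dominates x z -> ~~ dominates y z -> codist x y <= 2.
Proof.
move=> xz yz; apply: (@dist_adj2 (complement G) x y z).
  by rewrite adj_complement.
by rewrite adj_complement dominates_sym.
Qed.

(** If z were dominated by neither x nor y, then x, z, y would be a path in
    the complement: two vertices far apart in the complement form a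
    dominating edge. *)
Lemma codist_gt2_dominating x y : 2 < codist x y ->
  dominates x y /\ forall z, dominates x z || dominates y z.
Proof.
move=> far; split.
  by apply: contraLR far => /codist_nondominated; lia.
move=> z; apply: contraLR far; rewrite negb_or => /andP[xz yz].
by have := codist_commonly_nondominated xz yz; lia.
Qed.

Hypothesis conG : connected G.

Lemma dist_dominates2 x u v : dominates x u -> dominates x v -> dist u v <= 2.
Proof.
move=> /dist_dominates xu /dist_dominates xv.
by have := dist_triangle conG u x v; rewrite (dist_sym conG u x); lia.
Qed.

(** Everything is within one step of a dominating edge. *)
Lemma dist_le3_of_codist_gt2 x y : 2 < codist x y -> forall u v, dist u v <= 3.
Proof.
case/codist_gt2_dominating => /dist_dominates dxy dom u v.
have near z : dist z x <= 1 /\ dist x z <= 1 \/ dist z y <= 1 /\ dist y z <= 1.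
  case/orP: (dom z) => /dist_dominates near_z; [left|right].
    by rewrite (dist_sym conG z x).
  by rewrite (dist_sym conG z y).
have [tux tuy] := (dist_triangle conG u x v, dist_triangle conG u y v).
have [txy tyx] := (dist_triangle conG x y v, dist_triangle conG y x v).
have dyx := dist_sym conG y x.
have [[] | []] := near u; have [[] | []] := near v; lia.
Qed.

(** Two of three vertices are dominated by the same end of a dominating edge,
    hence are at distance at most 2. *)
Lemma dist_le2_of_codist_gt2 x y u v w : 2 < codist x y ->
  [|| dist u v <= 2, dist v w <= 2 | dist u w <= 2].
Proof.
case/codist_gt2_dominating => _ dom.
by case/orP: (dom u) => du; case/orP: (dom v) => dv; case/orP: (dom w) => dw;
   rewrite ?(dist_dominates2 du dv) ?(dist_dominates2 dv dw)
           ?(dist_dominates2 du dw) ?orbT.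
Qed.

Lemma uniq_full (s : seq G) z : uniq s -> size s = #|G| -> z \in s.
Proof.
move=> us szs; have /subset_cardP : #|s| = #|G| by rewrite (card_uniqP us).
by move=> /(_ (subset_predT _)) ->.
Qed.

(** Let u be far from both v and w, let xy be a dominating edge, and say that
    x dominates u.  Then x dominates neither v nor w, which are left to y, and
    y does not dominate u; so the five vertices are distinct.  When n = 5 they
    are all the vertices, and the path x, v, u, y of the complement, or the
    same path through w, meets any given one of them. *)
Lemma codist_sum_le3_oriented x y u v w z : #|G| = 5 -> 2 < codist x y ->
    2 < dist u v -> 2 < dist u w -> v != w -> dominates x u ->
  codist z x + codist z y <= 3.
Proof.
move=> card5 /codist_gt2_dominating[xy dom] uv uw vw xu.
have not_both (a b : G) : 2 < dist u b -> dominates a u -> ~~ dominates a b.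
  by move=> far au; apply: contraL far => /(dist_dominates2 au); lia.
have [xv xw] : ~~ dominates x v /\ ~~ dominates x w by split; apply: not_both.
have yv : dominates y v by have := dom v; rewrite (negbTE xv).
have yw : dominates y w by have := dom w; rewrite (negbTE xw).
have yu : ~~ dominates y u.
  by apply: contraL yv; exact: not_both.
have indep (b : G) : 2 < dist u b -> ~~ dominates u b.
  by apply: contraL => /dist_dominates le1; lia.
have dom_refl (a : G) : dominates a a by rewrite /dominates eqxx.
have neq (c a b : G) : dominates c a -> ~~ dominates c b -> a != b.
  by move=> ca; apply: contra => /eqP<-.
have distinct : uniq [:: x; y; u; v; w].
  have yx : dominates y x by rewrite dominates_sym.
  have ux : dominates u x by rewrite dominates_sym.
  have uy : ~~ dominates u y by rewrite dominates_sym.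
  rewrite /= !inE !negb_or vw !andbT (neq u x y) // (neq y x u) //.
  rewrite (neq x x v) // (neq x x w) // (neq y y u) // (neq x y v) //.
  by rewrite (neq x y w) // (neq x u v) // (neq x u w).
have path_le3 (b : G) : 2 < dist u b -> ~~ dominates x b ->
    codist x y <= 3 /\ codist y x <= 3.
  move=> ub xb; split.
    by apply: (@dist_adj3 (complement G) x b u y);
       rewrite adj_complement // dominates_sym // indep.
  by apply: (@dist_adj3 (complement G) y u b x);
     rewrite adj_complement // ?indep // dominates_sym.
have inner (b : G) : 2 < dist u b -> ~~ dominates x b ->
    codist b x + codist b y <= 3.
  move=> ub xb; apply: (@leq_add _ _ 1 2).
    by apply: codist_nondominated; rewrite dominates_sym.
  apply: (@codist_commonly_nondominated _ _ u) => //.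
  by rewrite dominates_sym indep.
have [xy3 yx3] := path_le3 v uv xv.
have := uniq_full z distinct; rewrite card5 => /(_ erefl).
rewrite !inE => /or4P[/eqP->|/eqP->|/eqP->|/orP[]/eqP->].
- by rewrite (@dist_refl (complement G)).
- by rewrite (@dist_refl (complement G)) addn0.
- apply: (@leq_add _ _ 2 1); last first.
    by apply: codist_nondominated; rewrite dominates_sym.
  by apply: (@codist_commonly_nondominated _ _ v); rewrite // indep.
- exact: inner.
- exact: inner.
Qed.
End Complementary.

Section CoConnected.
Variable G : sgraph.
Hypothesis conG : connected G.
Hypothesis conG' : connected (complement G).
Implicit Types x y z u v w : G.
Notation codist := (@dist (complement G)).

Lemma codist_sum_le3 x y u v w z : #|G| = 5 -> 2 < codist x y ->
  2 < dist u v -> 2 < dist u w -> v != w -> codist z x + codist z y <= 3.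
Proof.
move=> card5 far uv uw vw.
have [_ /(_ u)/orP[xu|yu]] := codist_gt2_dominating far.
  exact: codist_sum_le3_oriented far uv uw vw xu.
rewrite addnC; apply: codist_sum_le3_oriented uv uw vw yu => //.
by rewrite (dist_sym conG').
Qed.

Lemma dist_le3 : 6 < triameter (complement G) -> forall u v, dist u v <= 3.
Proof.
case/(sorted_triple conG') => x [y [z [lt ? ?]]].
by apply: (dist_le3_of_codist_gt2 conG (x := x) (y := y)); lia.
Qed.

(** Otherwise three vertices are pairwise at distance 3, which a dominating
    edge excludes. *)
Lemma triameter_le8 : 6 < triameter (complement G) -> triameter G <= 8.
Proof.
move=> lt6; have le3 := dist_le3 lt6; rewrite leqNgt; apply/negP.
case/(sorted_triple conG) => u [v [w [lt8 ? ?]]].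
have [x [y [z [far ? ?]]]] := sorted_triple conG' lt6.
have: 2 < codist x y by lia.
case/(dist_le2_of_codist_gt2 conG u v w)/or3P; have := le3 u v; lia.
Qed.

(** Perimeter 8 in G provides a vertex u at distance 3 from two others, and
    perimeter at least 7 in the complement a pair x, y at distance 3 there;
    the third vertex is then too close to x and y. *)
Lemma complement_triameter_le6 :
  #|G| = 5 -> 7 < triameter G -> triameter (complement G) <= 6.
Proof.
move=> card5 lt7; rewrite leqNgt; apply/negP => lt6; have le3 := dist_le3 lt6.
have [u [v [w [lt ? ?]]]] := sorted_triple conG lt7.
have [x [y [z [lt' ? ?]]]] := sorted_triple conG' lt6.
have [uv uw] := (le3 u v, le3 u w).
have vw : v != w.
  by apply/eqP => evw; have := dist_refl w; rewrite -{1}evw; lia.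
have xy : codist x y <= 3.
  apply: (@dist_le3_of_codist_gt2 (complement G) conG' u v).
  by rewrite dist_complementK; lia.
have : codist z x + codist z y <= 3.
  by apply: (@codist_sum_le3 x y u v w z); lia.
by rewrite (dist_sym conG' z x) (dist_sym conG' z y); lia.
Qed.
End CoConnected.

(** * The four bounds *)

(** A vertex c with two neighbours a, b in the complement is at distance at
    least 2 from both in G. *)
Lemma triameter_ge5 (G : sgraph) :
  3 <= #|G| -> co_connected G -> 5 <= triameter G.
Proof.
move=> card3 [conG conG'].
have [c [a [b [ab]]]] := exists_cherry conG' card3.
rewrite !adj_complement => ac cb; apply/triameter_gtP; exists a, c, b.
have ge1 (x y : G) : x != y -> 0 < dist x y.
  move=> xy; have [p [_ lp <-]] := dist_witness (conG x y).
  by case: p lp xy => //= ->; rewrite eqxx.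
have ge2 (x y : G) : ~~ dominates x y -> 1 < dist x y.
  have [[|z [|t p]] [pp lp <-]] := dist_witness (conG x y) => //.
    by rewrite -lp /dominates eqxx.
  by move: pp lp => /= /andP[xz _] <-; rewrite /dominates xz orbT.
have := ge1 _ _ ab; have := ge2 _ _ ac; have := ge2 _ _ cb.
rewrite /perimeter; lia.
Qed.

Lemma triameter_le6 (G : sgraph) : diameter G <= 2 -> triameter G <= 6.
Proof.
move=> /diameter_leP le2; apply/triameter_leP => u v w; rewrite /perimeter.
by have := le2 u v; have := le2 v w; have := le2 u w; lia.
Qed.

Lemma co_connected_complement (G : sgraph) :
  co_connected G -> co_connected (complement G).
Proof. by case=> conG conG'; split=> //; exact: connected_complementK. Qed.

Lemma diameter_eq3 (G : sgraph) : co_connected G ->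
  6 < triameter G -> 6 < triameter (complement G) -> diameter G = 3.
Proof.
case=> conG conG' lt6 lt6'; apply/eqP; rewrite eqn_leq; apply/andP; split.
  by apply/diameter_leP; exact: dist_le3.
by rewrite ltnNge; apply: contraL lt6 => /triameter_le6; rewrite -leqNgt.
Qed.

Lemma triameters_upper (G : sgraph) : 4 <= #|G| -> co_connected G ->
  triameter G + triameter (complement G) <= 2 * #|G| + 4 /\
  (~ in_family_F G ->
    triameter G * triameter (complement G) <= 12 * (#|G| - 1)).
Proof.
move=> card4 coG; have [conG conG'] := coG.
have coG' := co_connected_complement coG.
have le_t := triameter_le_card conG.
have le_t' : triameter (complement G) <= 2 * (#|G| - 1).
  exact: (triameter_le_card conG').
(* When n = 4 the bound 2(n - 1) = 6 already puts both in the easy case. *)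
have [le6|lt6] := leqP (triameter G) 6; first by split=> [|_]; nia.
have [le6|lt6'] := leqP (triameter (complement G)) 6.
  by split=> [|_]; nia.
have lt6cc : 6 < triameter (complement (complement G)).
  by rewrite triameter_complementK.
have le8 := triameter_le8 conG conG' lt6'.
have le8' := triameter_le8 coG'.1 coG'.2 lt6cc.
split=> [|notF].
  have [card5|card5] := eqVneq #|G| 5; last lia.
  have le7 : triameter G <= 7.
    rewrite leqNgt; apply: contraL lt6'.
    by move=> /(complement_triameter_le6 conG conG' card5); lia.
  have le7' : triameter (complement G) <= 7.
    rewrite leqNgt; apply: contraL lt6cc.
    by move=> /(complement_triameter_le6 coG'.1 coG'.2 card5); lia.
  lia.
have card8 : 8 <= #|G|.
  rewrite leqNgt; apply/negP => lt8; apply: notF; split=> //.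
  - by rewrite !inE; lia.
  - by split; apply: diameter_eq3.
  - by rewrite !inE; lia.
  - by rewrite !inE; lia.
nia.
Qed.

Lemma co_connected_of_hamiltonian_paths (G : sgraph) (x y : G) (p q : seq G) :
  path (@adj G) x p -> path (@adj (complement G)) y q ->
  (forall z : G, (z \in x :: p) && (z \in y :: q)) -> co_connected G.
Proof.
have con (H : sgraph) (a : H) (s : seq H) :
    path (@adj H) a s -> (forall z, z \in a :: s) -> connected H.
  move=> pas full b c; apply: (@connect_trans _ _ a); last first.
    exact: path_connect pas _ (full c).
  rewrite (sym_connect_sym (@adj_sym H)).
  exact: path_connect pas _ (full b).
by move=> px qy full; split; [apply: con px _ | apply: con qy _] => z;
   case/andP: (full z).
Qed.

(** * The two extremal graphs *)

Definition P4_adj : rel 'I_4 := fun i j => (i.+1 == j) || (j.+1 == i).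

Lemma P4_adj_sym : symmetric P4_adj.
Proof. by move=> i j; rewrite /P4_adj orbC. Qed.

Lemma P4_adj_irrefl : irreflexive P4_adj.
Proof. by move=> i; rewrite /P4_adj; lia. Qed.

Definition P4 : sgraph := SGraph P4_adj_sym P4_adj_irrefl.

Definition C5_adj : rel 'I_5 :=
  fun i j => (i.+1 %% 5 == j) || (j.+1 %% 5 == i).

Lemma C5_adj_sym : symmetric C5_adj.
Proof. by move=> i j; rewrite /C5_adj orbC. Qed.

Lemma C5_adj_irrefl : irreflexive C5_adj.
Proof. by move=> [[|[|[|[|[|m]]]]] lt]. Qed.

Definition C5 : sgraph := SGraph C5_adj_sym C5_adj_irrefl.

Notation o4 m := (@Ordinal 4 m isT).
Notation o5 m := (@Ordinal 5 m isT).

Lemma P4_co_connected : co_connected P4.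
Proof.
apply: (@co_connected_of_hamiltonian_paths P4 (o4 0) (o4 1)
          [:: o4 1; o4 2; o4 3] [:: o4 3; o4 0; o4 2]) => //.
by move=> [[|[|[|[|m]]]] lt].
Qed.

Lemma C5_co_connected : co_connected C5.
Proof.
apply: (@co_connected_of_hamiltonian_paths C5 (o5 0) (o5 0)
  [:: o5 1; o5 2; o5 3; o5 4] [:: o5 2; o5 4; o5 1; o5 3]) => //.
by move=> [[|[|[|[|[|m]]]]] lt].
Qed.

(** The degenerate triple u, v, v counts the distance from u to v twice. *)
Lemma triameter_ge6 (G : sgraph) (u v : G) : connected G ->
  u != v -> ~~ adj u v -> (forall z, ~~ (adj u z && adj z v)) ->
  6 <= triameter G.
Proof.
move=> conG neq nadj none; have far := dist_gt2 conG neq nadj none.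
have := leq_triameter u v v; rewrite /perimeter dist_refl; lia.
Qed.

Lemma P4_triameter : triameter P4 = 6 /\ triameter (complement P4) = 6.
Proof.
have [con con'] := P4_co_connected.
have le6 := triameter_le_card con; have le6' := triameter_le_card con'.
rewrite card_ord in le6 le6'.
(* The ends of the path 0123, and of its complement 1302. *)
split; apply/eqP; rewrite eqn_leq ?le6 ?le6' /=.
  apply: (@triameter_ge6 P4 (o4 0) (o4 3)) => //.
  by move=> [[|[|[|[|m]]]] lt].
apply: (@triameter_ge6 (complement P4) (o4 1) (o4 2)) => //.
by move=> [[|[|[|[|m]]]] lt].
Qed.

(** Diameter at most 2, and no three vertices pairwise at distance 2. *)
Lemma triameter_le5 (G : sgraph) :
  (forall x y : G, dominates x y || [exists z, adj x z && adj z y]) ->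
  (forall x y z : G, [|| dominates x y, dominates y z | dominates x z]) ->
  triameter G <= 5.
Proof.
move=> common no_indep; apply/triameter_leP => u v w; rewrite /perimeter.
have le2 (x y : G) : dist x y <= 2.
  case/orP: (common x y) => [/dist_dominates/leqW //|].
  by case/existsP => z /andP[]; exact: dist_adj2.
have := le2 u v; have := le2 v w; have := le2 u w.
by case/or3P: (no_indep u v w) => /dist_dominates; lia.
Qed.

Lemma C5_triameter : triameter C5 = 5 /\ triameter (complement C5) = 5.
Proof.
have card3 : 3 <= #|C5| by rewrite card_ord.
have ge5 := triameter_ge5 card3 C5_co_connected.
have ge5' := triameter_ge5 (card3 : 3 <= #|complement C5|)
                           (co_connected_complement C5_co_connected).
split; apply/eqP; rewrite eqn_leq ?ge5 ?ge5' andbT; apply: triameter_le5.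
- by move=> [[|[|[|[|[|i]]]]] lti] [[|[|[|[|[|j]]]]] ltj] //; apply/existsP;
    first [ by exists (o5 0) | by exists (o5 1) | by exists (o5 2)
          | by exists (o5 3) | by exists (o5 4) ].
- by move=> [[|[|[|[|[|i]]]]] lti] [[|[|[|[|[|j]]]]] ltj]
            [[|[|[|[|[|k]]]]] ltk].
- by move=> [[|[|[|[|[|i]]]]] lti] [[|[|[|[|[|j]]]]] ltj] //; apply/existsP;
    first [ by exists (o5 0) | by exists (o5 1) | by exists (o5 2)
          | by exists (o5 3) | by exists (o5 4) ].
- by move=> [[|[|[|[|[|i]]]]] lti] [[|[|[|[|[|j]]]]] ltj]
            [[|[|[|[|[|k]]]]] ltk].
Qed.

Theorem theorem5p1 :
  (forall G : sgraph, 4 <= #|G| -> co_connected G ->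
     10 <= triameter G + triameter (complement G) <= 2 * #|G| + 4
     /\ (~ in_family_F G ->
         25 <= triameter G * triameter (complement G) <= 12 * (#|G| - 1)))
  /\ [/\ exists G : sgraph, [/\ 4 <= #|G|, co_connected G
           & triameter G + triameter (complement G) = 10],
         exists G : sgraph, [/\ 4 <= #|G|, co_connected G
           & triameter G + triameter (complement G) = 2 * #|G| + 4],
         exists G : sgraph, [/\ 4 <= #|G|, co_connected G, ~ in_family_F G
           & triameter G * triameter (complement G) = 25]
       & exists G : sgraph, [/\ 4 <= #|G|, co_connected G, ~ in_family_F G
           & triameter G * triameter (complement G) = 12 * (#|G| - 1)]].
Proof.
split=> [G card4 coG|].
  have [sum_le prod_le] := triameters_upper card4 coG.
  have t5 := triameter_ge5 (ltnW card4) coG.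
  have t5' := triameter_ge5 (ltnW card4 : 3 <= #|complement G|)
                            (co_connected_complement coG).
  split=> [|/prod_le le]; apply/andP; split=> //; first lia.
  exact: (leq_mul t5 t5').
have [tP tP'] := P4_triameter; have [tC tC'] := C5_triameter.
have P4_notF : ~ in_family_F P4 by case=> _; rewrite card_ord.
have C5_notF : ~ in_family_F C5 by case=> _ _ _; rewrite tC.
have [coP coC] := (P4_co_connected, C5_co_connected).
split; [exists C5 | exists P4 | exists C5 | exists P4];
  by split; rewrite ?card_ord // ?tP ?tP' ?tC ?tC'.
Qed.
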